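(* Assume that $h=\nabla H$ and $f=\nabla F$ are Lipschitz continuous, that $A(x,y)=E(x)+\left(\frac{L}{2}+\frac{1}{3\delta t}\right)\|x-y\|^2$ (a function on $X\times X$) is a KL function, and that $\lambda_{\max}<\sqrt{\frac{4}{3\delta t L}-\frac12}-1$. Let $\{u^n\}_n$ be a sequence generated by Algorithm FlowBBAp with the MPCLS line search (both described in the context) for minimizing $E=H+F$. Then the following statements hold. (i) $\lim_{n\to\infty}\|\nabla A(u^{n+1},u^n)\|=0$. (ii) The sequence $\{A(u^{n+1},u^n)\}_n$ is monotone decreasing with a limit, and the sequence $\{u^n\}_n$ is bounded. Specifically, there exists a constant $\zeta$ such that $\lim_{n\to\infty}A(u^{n+1},u^n)=\zeta$. (iii) The sequence $\{u^n\}_n$ converges to a critical point of $E$; moreover $\sum_{n=0}^\infty\|u^{n+1}-u^n\|<\infty$.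
   Context: Setting. $X$ is a finite-dimensional Hilbert space; $E=H+F$, where $H$ is a convex, differentiable function on $X$ with Lipschitz continuous gradient $h=\nabla H$, and $F$ is differentiable with gradient $f=\nabla F$ Lipschitz continuous with constant $L>0$. $E$ is level-bounded: $\{x:E(x)\le a\}$ is bounded (possibly empty) for every $a\in\mathbb{R}$. $M$ is a self-adjoint positive-semidefinite linear operator on $X$, $\|u\|_M^2:=\langle Mu,u\rangle$. A critical point of $E$ is a point where $\nabla E=0$. Algorithm FlowBBAp with MPCLS line search. Parameters: $0<\delta t<\frac{2}{3L}$, $\alpha>0$, $0<\beta<1$, $\bar\lambda_{\max}>0$; start with $u^0\in X$, $u^{-1}=u^0$. For $n=0,1,2,\dots$ put $H^n(u)=H(u)+\frac{1}{\delta t}\|u-u^n\|^2$, $F^n(u)=\frac{1}{3\delta t}\|u-u^{n-1}\|^2-F(u)-\langle f(u^n)-f(u^{n-1}),u-u^{n-1}\rangle$, $E^n(u)=H^n(u)-F^n(u)$, and compute $y^n=\arg\min_u\{H^n(u)-\langle\nabla F^n(u^n),u\rangle+\frac12\|u-u^n\|_M^2\}$, $d^n=y^n-u^n$. Then $\lambda_n$ is the first number in the list $\bar\lambda_{\max},\beta\bar\lambda_{\max},\beta^2\bar\lambda_{\max},\dots$ satisfying $E^n(y^n+\lambda_n d^n)\le E^n(y^n)-\alpha\lambda_n\|d^n\|^2$ (it is part of ''generated by the algorithm'' that such a number exists at every step), and $u^{n+1}=y^n+\lambda_n d^n$. Infinite sequences of iterates are considered (if $d^n=0$ this rule gives $u^{n+1}=u^n$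 and the iteration goes on). Notation: $\lambda_{\max}:=\max\{\lambda_n: n\ge1\}$. KL function. A proper closed function $g$ on a finite-dimensional space is a KL function if for every critical point $\bar x$ of $g$ (i.e. $0\in\partial g(\bar x)$; $\partial g$ is the limiting subdifferential, equal to $\{\nabla g\}$ if $g$ is $C^1$) there exist $\nu\in(0,+\infty]$, a neighborhood $\mathcal{O}$ of $\bar x$, and a continuous concave function $\psi:[0,\nu)\to[0,+\infty)$ with $\psi(0)=0$, continuously differentiable on $(0,\nu)$ with $\psi'>0$ there, such that $\psi'(g(x)-g(\bar x))\cdot\mathrm{dist}(0,\partial g(x))\ge1$ for all $x\in\mathcal{O}$ with $g(\bar x)<g(x)<g(\bar x)+\nu$. *)

(* Defs.v *)
From HB Require Import structures.
From mathcomp Require Import all_boot all_order all_algebra.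
From mathcomp Require Import all_classical all_reals all_analysis.

Set Implicit Arguments.
Unset Strict Implicit.
Unset Printing Implicit Defensive.

Import Order.TTheory GRing.Theory Num.Theory.
Import numFieldNormedType.Exports.
Local Open Scope classical_set_scope.
Local Open Scope ring_scope.

#[short(type="finNormedModType")]
HB.structure Definition FinNormedModule (R : numFieldType) :=
  {V of NormedModule R V & Vector R V}.

(* The inner product is an argument, separate from the library norm: on Y * Y
   the library norm is the max norm, which induces the right topology but is
   not the Hilbert norm. Hence [hnorm], used throughout this section. *)
Section InnerProduct.
Variables (R : realType) (Y : normedModType R).
Implicit Types (dot : Y -> Y -> R) (x v : Y).

Definition hnorm dot v : R := Num.sqrt (dot v v).

Definition prod_dot dot (p q : Y * Y) : R := dot p.1 q.1 + dot p.2 q.2.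

Definition is_gradient dot (g : Y -> R) x v : Prop :=
  differentiable g x /\ forall w, 'd g x w = dot v w.

(* 0 where g has no gradient *)
Definition gradient dot (g : Y -> R) x : Y := xget 0 (is_gradient dot g x).

(* g y >= g x + <v, y - x> + o(|y - x|) *)
Definition frechet_subdiff dot (g : Y -> \bar R) x : set Y :=
  [set v | g x \is a fin_num /\
    forall eps : R, 0 < eps -> \forall y \near x,
      (g x + (dot v (y - x) - eps * hnorm dot (y - x))%:E <= g y)%E].

Definition limiting_subdiff dot (g : Y -> \bar R) x : set Y :=
  [set v | g x \is a fin_num /\
    exists xs vs : nat -> Y,
      [/\ xs @ \oo --> x,
          (fun k => g (xs k)) @ \oo --> g x,
          vs @ \oo --> v &
          forall k, frechet_subdiff dot g (xs k) (vs k)]].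

(* +oo when S is empty *)
Definition dist0 dot (S : set Y) : \bar R :=
  ereal_inf [set (hnorm dot v)%:E | v in S].

Definition proper_fun (g : Y -> \bar R) : Prop :=
  (forall x, g x != -oo%E) /\ exists x, (g x < +oo)%E.

Definition desingularizing (nu : \bar R) (psi : R -> R) : Prop :=
  let D : set R := [set t | 0 <= t /\ (t%:E < nu)%E] in
  [/\ forall t, D t -> 0 <= psi t,
      psi 0 = 0,
      {within D, continuous psi},
      @convex_function R R^o D (fun t => - psi t) &
      forall t : R, 0 < t -> (t%:E < nu)%E ->
        [/\ derivable psi t 1, {for t, continuous (derive1 psi)} &
            0 < derive1 psi t]].

Definition KL_function dot (g : Y -> \bar R) : Prop :=
  [/\ proper_fun g, lower_semicontinuous g &
      forall xbar, limiting_subdiff dot g xbar 0 ->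
        exists (nu : \bar R) (psi : R -> R),
          [/\ (0 < nu)%E, desingularizing nu psi &
              \forall x \near xbar,
                (g xbar < g x)%E -> (g x < g xbar + nu)%E ->
                (1 <= (derive1 psi (fine (g x - g xbar)))%:E
                      * dist0 dot (limiting_subdiff dot g x))%E]].

End InnerProduct.

Section FlowBBAp.
Variables (R : realType) (X : normedModType R) (dot : X -> X -> R).
Variables (H F : X -> R) (f : X -> X) (M : X -> X).
Variables (L dt alpha beta lbar : R).

(* un and up stand for u^n and u^(n-1) *)
Definition Hn (un v : X) : R := H v + dt^-1 * `|v - un| ^+ 2.

Definition Fn (un up v : X) : R :=
  (3 * dt)^-1 * `|v - up| ^+ 2 - F v - dot (f un - f up) (v - up).

Definition En (un up v : X) : R := Hn un v - Fn un up v.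

Definition subproblem (un up v : X) : R :=
  Hn un v - dot (gradient dot (Fn un up) un) v
  + 2^-1 * dot (M (v - un)) (v - un).

Definition MPCLS_ok (un up yn : X) (l : R) : Prop :=
  En un up (yn + l *: (yn - un))
    <= En un up yn - alpha * l * `|yn - un| ^+ 2.

(* [u n.-1] is u^(n-1), with u^(-1) = u^0 since [0.-1 = 0] *)
Definition FlowBBAp_MPCLS (u y : nat -> X) (lam : nat -> R) : Prop :=
  forall n,
    [/\ forall v, subproblem (u n) (u n.-1) (y n)
                    <= subproblem (u n) (u n.-1) v,
        exists k : nat,
          [/\ lam n = beta ^+ k * lbar,
              MPCLS_ok (u n) (u n.-1) (y n) (lam n) &
              forall j : nat, (j < k)%N ->
                ~ MPCLS_ok (u n) (u n.-1) (y n) (beta ^+ j * lbar)] &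
        u n.+1 = y n + lam n *: (y n - u n)].

Definition potential (z : X * X) : R :=
  (H z.1 + F z.1) + (L / 2 + (3 * dt)^-1) * `|z.1 - z.2| ^+ 2.

End FlowBBAp.

(* Main.v *)
Require Import Defs.
From HB Require Import structures.
From mathcomp Require Import all_boot all_order all_algebra.
From mathcomp Require Import all_classical all_reals all_analysis.
From mathcomp Require Import ring lra.

Set Implicit Arguments.
Unset Strict Implicit.
Unset Printing Implicit Defensive.

Import Order.TTheory GRing.Theory Num.Theory.
Import numFieldNormedType.Exports.
Local Open Scope classical_set_scope.
Local Open Scope ring_scope.

(** The proof rests on the potential [A (x, y) = E x + K * `|x - y| ^+ 2] with
    [K = L / 2 + 1 / (3 dt)], evaluated along the pairs [(u n.+1, u n)].

    One step. [Fn] is built so that its quadratic term dominates the curvature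
    of [- F], whereas [Hn] and the subproblem are strongly convex. Comparing the
    minimizer [yn] of the subproblem with [un] therefore gives a decrease of [En]
    by at least [q * `|yn - un| ^+ 2], with [q = 4 / (3 dt) - L / 2]
    ([En_decrease]). The line search does not lose it, and
    [u n.+1 - u n = (1 + lam n) *: (yn - un)]. Once [En] is expanded, the cross
    terms with [u n - u n.-1] are absorbed by the two copies of
    [K * `|x - y| ^+ 2], and what remains is a decrease of [A] by
    [(q / (1 + lam n) ^+ 2 - L) * `|u n.+1 - u n| ^+ 2] ([potential_decrease]).
    The bound on [lmax] says exactly that this coefficient stays positive.
    Conversely, the optimality condition of the subproblem and the Lipschitz
    gradients bound the gradient of [E] at [u n.+1] by the last two steps
    ([gradE_bound]).

    Limits. The level sets of [E] being bounded, so are the iterates; [A] is then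
    bounded below along them, its values converge, and the steps and the
    gradients of [A] tend to 0. In finite dimension the iterates have a cluster
    point [x], which is critical ([cluster_critical]).

    Convergence. Near [(x, x)] the Kurdyka-Lojasiewicz inequality, together with
    the concavity of the desingularizing function [psi], turns decrease and
    gradient bound into
    [4 * a n.+2 <= a n.+1 + a n + C' * (phi n.+1 - phi n.+2)]
    for the step lengths [a] and [phi n = psi (A (u n.+1, u n) - E x)]
    ([KL_step]). This recursion telescopes, so the total length is finite and,
    when started close enough to [x], the iterates never leave the neighborhood
    where it holds ([finite_length_cvg], [finite_length_sum]). *)

(** * Finite-dimensional normed spaces *)

Section FiniteDimension.
Variables (R : realType) (X : finNormedModType R).

Let n := \dim (fullv : {vspace X}).
Let e : n.-tuple X := vbasis fullv.
Let lincomb (c : 'rV[R]_n) : X := \sum_i c 0 i *: e`_i.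
Let coords (x : X) : 'rV[R]_n := \row_i coord e i x.

Let coordsK : cancel coords lincomb.
Proof.
move=> x; rewrite {2}(coord_vbasis (memvf x)); apply: eq_bigr => i _.
by rewrite mxE.
Qed.

Let lincombK : cancel lincomb coords.
Proof.
move=> c; apply/rowP => i; rewrite mxE coord_sum_free//.
exact/basis_free/vbasisP.
Qed.

Let lincomb_linear : linear lincomb.
Proof.
move=> k c d; rewrite scaler_sumr -big_split/=; apply: eq_bigr => i _.
by rewrite !mxE scalerDl scalerA.
Qed.

HB.instance Definition _ := GRing.isLinear.Build R 'rV[R]_n X _ lincomb
  lincomb_linear.

Let coord_le (c : 'rV[R]_n) i : `|c 0 i| <= `|c|.
Proof.
rewrite [leRHS]/Num.norm/= mx_normrE.
by apply/bigmax_geP; right; exists (0, i).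
Qed.

Let lincomb_continuous : continuous lincomb.
Proof.
apply: bounded_linear_continuous; apply/linear_boundedP.
exists (\sum_(i < n) `|e`_i|); split; first exact: num_real.
move=> r /ltW br c; apply: (@le_trans _ _ ((\sum_(i < n) `|e`_i|) * `|c|)).
  rewrite (le_trans (ler_norm_sum _ _ _))// mulr_suml.
  by apply: ler_sum => i _; rewrite normrZ mulrC ler_wpM2l.
by rewrite ler_wpM2r.
Qed.

(** [lincomb] does not vanish on the unit sphere of row vectors, which is
    compact; so its norm has a positive minimum there, whose inverse bounds the
    coordinates. *)
Let coords_bounded : exists C : R, forall x : X, `|coords x| <= C * `|x|.
Proof.
pose S := [set c : 'rV[R]_n | `|c| = 1].
have coords_neq0 x : x != 0 -> coords x != 0.
  by apply: contra => /eqP cx0; rewrite -[x]coordsK cx0 linear0.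
have coords0 : coords 0 = 0 by rewrite -[RHS]lincombK linear0.
(* The sphere is empty in dimension 0. *)
have [S0|/set0P S0] := eqVneq S set0.
  exists 0 => x; rewrite mul0r normr_le0; apply: contrapT => /negP vx0.
  suff : S (`|coords x|^-1 *: coords x) by rewrite S0.
  by rewrite /S/= normrZ normfV normr_id mulVf// normr_eq0.
have cS : compact S.
  apply: bounded_closed_compact.
    by exists 1; split => // r r1 c /= ->; exact: ltW.
  have -> : S = (@Num.norm _ 'rV[R]_n) @^-1` [set 1] by [].
  by apply: preimage_closed; [move=> c _; exact: norm_continuous|exact: closed_eq].
have [c Sc cmin] : exists2 c, c \in S &
    forall t, t \in S -> `|lincomb c| <= `|lincomb t|.
  apply: (@compact_EVT_min _ _ (fun c : 'rV_n => `|lincomb c|)) => //.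
  apply: continuous_subspaceT => c.
  by apply: continuous_comp; [exact: lincomb_continuous|exact: norm_continuous].
have c0 : 0 < `|lincomb c|.
  rewrite normr_gt0; apply/eqP => rc0.
  move: Sc; rewrite inE /S/= -[c]lincombK rc0 coords0 normr0 => /eqP.
  by rewrite eq_sym oner_eq0.
exists (`|lincomb c|^-1) => x.
have [->|x0] := eqVneq x 0; first by rewrite coords0 !normr0 mulr0.
have vx0 : 0 < `|coords x| by rewrite normr_gt0 coords_neq0.
rewrite ler_pdivlMl//.
have := cmin (`|coords x|^-1 *: coords x).
rewrite inE /S/= normrZ normfV normr_id mulVf ?gt_eqF// => /(_ erefl).
by rewrite linearZ/= coordsK normrZ normfV normr_id ler_pdivlMl// mulrC.
Qed.

Lemma finite_dim_linear_bounded (Y : normedModType R) (M : {linear X -> Y}) :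
  exists C : R, forall x, `|M x| <= C * `|x|.
Proof.
have [C Cv] := coords_bounded.
exists ((\sum_(i < n) `|M e`_i|) * C) => x.
rewrite -{1}[x]coordsK linear_sum (le_trans (ler_norm_sum _ _ _))//.
rewrite !mulr_suml; apply: ler_sum => i _.
rewrite linearZ normrZ mulrC -mulrA ler_wpM2l//.
exact: le_trans (coord_le _ _) (Cv x).
Qed.

(** The coordinates of the sequence stay in a compact ball of row vectors, and a
    cluster point of the coordinates is sent to one of the sequence. *)
Lemma bounded_seq_cluster (u : nat -> X) (B : R) : (forall n, `|u n| <= B) ->
  exists x, forall eps : R, 0 < eps ->
    forall N, exists2 n, (N <= n)%N & `|u n - x| < eps.
Proof.
move=> uB; have [C Cv] := coords_bounded.
pose K := [set c : 'rV[R]_n | `|c| <= `|C| * B].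
have cK : compact K.
  apply: bounded_closed_compact.
    exists (`|C| * B); split; first exact: num_real.
    by move=> r /ltW Br c /= /le_trans; exact.
  have -> : K = (@Num.norm _ 'rV[R]_n) @^-1` [set t | t <= `|C| * B] by [].
  by apply: preimage_closed; [move=> c _; exact: norm_continuous|exact: closed_le].
have vK k : K (coords (u k)).
  apply: (le_trans (Cv _)); apply: (@le_trans _ _ (`|C| * `|u k|)).
    by rewrite ler_wpM2r// ler_norm.
  by rewrite ler_wpM2l.
have [|c [_ cc]] := cK ((coords \o u) @ \oo) _.
  by exists 0%N => // k _ /=; exact: vK.
exists (lincomb c) => eps eps0 N.
have [] := cc ((coords \o u) @` [set k | (N <= k)%N])
              (lincomb @^-1` ball (lincomb c) eps).
- by exists N => // k /= Nk; exists k.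
- by apply: lincomb_continuous; exact: nbhsx_ballx.
- move=> _ [[k Nk <-]] /=; rewrite coordsK -ball_normE /ball_/= distrC => ?.
  by exists k.
Qed.

End FiniteDimension.

(** * Inner products and gradients *)

(** The upper bound leaves room for the factor lost between the max norm of a
    product space and its Hilbert norm. *)
Definition inner_product_on (R : realType) (Y : normedModType R)
    (dot : Y -> Y -> R) : Prop :=
  [/\ forall v w, dot v w = dot w v,
      forall v w z, dot v (w + z) = dot v w + dot v z,
      forall v a w, dot v (a *: w) = a * dot v w &
      forall v, `|v| ^+ 2 <= dot v v <= 2 * `|v| ^+ 2].

Section Gradient.
Variables (R : realType) (Y : normedModType R) (dot : Y -> Y -> R).
Hypothesis dotP : inner_product_on dot.
Implicit Types (g : Y -> R) (x v w : Y).

Let dotC v w : dot v w = dot w v. Proof. by case: dotP. Qed.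
Let dotDr v w z : dot v (w + z) = dot v w + dot v z.
Proof. by case: dotP. Qed.
Let dotZr v a w : dot v (a *: w) = a * dot v w.
Proof. by case: dotP. Qed.
Let dotDl v w z : dot (v + w) z = dot v z + dot w z.
Proof. by rewrite dotC dotDr dotC [dot z w]dotC. Qed.
Let dotZl a v w : dot (a *: v) w = a * dot v w.
Proof. by rewrite dotC dotZr dotC. Qed.
Let dot_ge v : `|v| ^+ 2 <= dot v v.
Proof. by case: dotP => _ _ _ /(_ v) /andP[]. Qed.
Let dot_ge0 v : 0 <= dot v v.
Proof. by apply: le_trans (dot_ge v); exact: exprn_ge0. Qed.

Lemma norm_le_hnorm v : `|v| <= hnorm dot v.
Proof.
by rewrite -(@ler_pXn2r _ 2) ?nnegrE ?sqrtr_ge0// sqr_sqrtr.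
Qed.

Lemma dot_linear v : linear (dot v : Y -> R^o).
Proof. by move=> a w z; rewrite dotDr dotZr. Qed.

Lemma dot_eq v w : (forall z, dot v z = dot w z) -> v = w.
Proof.
move=> vw; apply/eqP; rewrite -subr_eq0 -normr_eq0 -sqrf_eq0.
rewrite eq_le exprn_ge0// andbT (le_trans (dot_ge _))//.
by rewrite -scaleN1r dotDl dotZl vw mulN1r subrr.
Qed.

Lemma cauchy_schwarz v w : `|dot v w| <= hnorm dot v * hnorm dot w.
Proof.
rewrite -(@ler_pXn2r _ 2) ?nnegrE ?mulr_ge0 ?sqrtr_ge0//.
rewrite exprMn !sqr_sqrtr// real_normK ?num_real//.
have [w0|w0] := eqVneq (dot w w) 0.
  suff -> : w = 0 by rewrite -(scale0r 0) !dotZr !mul0r expr0n mulr0.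
  apply/eqP; rewrite -normr_eq0 -sqrf_eq0.
  by rewrite eq_le exprn_ge0// andbT -w0.
have wp : 0 < dot w w by rewrite lt_def w0 dot_ge0.
(* [dot w w] times the projection of [v] orthogonally to [w] *)
have := dot_ge0 (dot w w *: v + (- dot v w) *: w).
rewrite !(dotDl, dotDr, dotZl, dotZr) [dot w v]dotC => h.
rewrite -subr_ge0 -(pmulr_rge0 _ wp); lra.
Qed.

Lemma dot_bounded v : exists2 B : R, 0 <= B & forall w, `|dot v w| <= B * `|w|.
Proof.
exists (hnorm dot v * Num.sqrt 2); first by rewrite mulr_ge0 ?sqrtr_ge0.
move=> w; rewrite (le_trans (cauchy_schwarz _ _))// -mulrA ler_wpM2l ?sqrtr_ge0//.
rewrite -[`|w|]ger0_norm// -sqrtr_sqr -sqrtrM// ler_wsqrtr//.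
by case: dotP => _ _ _ /(_ w) /andP[].
Qed.

Lemma is_gradient_unique g x v w :
  is_gradient dot g x v -> is_gradient dot g x w -> v = w.
Proof. by move=> [_ gv] [_ gw]; apply: dot_eq => z; rewrite -gv -gw. Qed.

Lemma gradient_eq g x v : is_gradient dot g x v -> gradient dot g x = v.
Proof.
move=> gv; apply: (is_gradient_unique _ gv).
by apply: xgetPex; exists v.
Qed.

(** Functions with a Lipschitz gradient have a first-order expansion with
    quadratic remainder, and such expansions add up; so this criterion yields
    the gradient of a combination of [H], [F] and squared norms in one go. *)
Lemma is_gradient_quadratic g x v (C : R) :
  (forall w, `|g (x + w) - g x - dot v w| <= C * `|w| ^+ 2) ->
  is_gradient dot g x v.
Proof.
move=> gC.
pose l : Y -> R := dot v.
pose lM := GRing.isLinear.Build R Y R^o _ l (dot_linear v).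
pose L : {linear Y -> R^o} := HB.pack l lM.
have Lc : continuous L.
  apply: bounded_linear_continuous; apply/linear_boundedP.
  have [B B0 lB] := dot_bounded v.
  exists B; split; first exact: num_real.
  by move=> r /ltW Br w; rewrite (le_trans (lB w))// ler_wpM2r.
have gE : g \o shift x = cst (g x) + L +o_ 0 id.
  apply/eqaddoP => _ /posnumP[e].
  have C1 : 0 < `|C| + 1 by rewrite ltr_wpDl.
  have : \forall w \near (0 : Y), `|w| < e%:num / (`|C| + 1).
    by apply: cvgr0_norm_lt; [exact: cvg_id|rewrite divr_gt0].
  apply: filterS => w; rewrite ltr_pdivlMr// => we.
  have -> : (g \o shift x - (cst (g x) + L)) w = g (x + w) - g x - dot v w.
    by rewrite /= !fctE /= opprD addrA addrC [w + x]addrC addrC.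
  rewrite (le_trans (gC w))// expr2 mulrA ler_wpM2r//.
  have : C * `|w| <= (`|C| + 1) * `|w|.
    by rewrite ler_wpM2r// ler_wpDr// ler_norm.
  by rewrite mulrC; move/le_trans; apply; rewrite mulrC ltW// mulrC.
have dE : 'd g x = L :> (Y -> R) by exact: diff_unique.
split; last by move=> w; rewrite dE.
by apply/diff_locallyP; rewrite dE; split.
Qed.

(** The gradient is already a Frechet subgradient, since the norm of the
    space, which measures the remainder, is at most the Hilbert norm; constant
    sequences then show that it is a limiting one. *)
Lemma is_gradient_limiting_subdiff g x v : is_gradient dot g x v ->
  limiting_subdiff dot (fun y => (g y)%:E) x v.
Proof.
move=> [dg gv]; split=> //; exists (fun=> x), (fun=> v).
split; try exact: cvg_cst.
move=> _; split=> // e e0.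
have /diff_locallyP[_ /eqaddoP/(_ e e0)] := dg.
rewrite (near_shift 0 x) subr0; apply: filterS => w /=.
rewrite !fctE /= gv addrK.
rewrite -EFinD lee_fin ler_norml => /andP[+ _].
have : e * `|w| <= e * hnorm dot w.
  by apply: ler_wpM2l; [exact: ltW|exact: norm_le_hnorm].
lra.
Qed.

End Gradient.

Section HilbertNorm.
Variables (R : realType) (X : normedModType R) (dot : {dot X for idfun}).
Hypothesis hdot : forall x : X, `|x| = hnorm dot x.

Lemma dot_form_ge0 (x : X) : 0 <= dot x x.
Proof.
have [->|x0] := eqVneq x 0; first by rewrite linear0.
by apply: ltW; exact: neq0_dnorm_gt0.
Qed.

Lemma sqr_normE (x : X) : `|x| ^+ 2 = dot x x.
Proof. by rewrite hdot sqr_sqrtr// dot_form_ge0. Qed.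

Lemma inner_product_dot : inner_product_on dot.
Proof.
split.
- by move=> v w; rewrite hermC expr0 mul1r.
- by move=> v w z; rewrite linearD.
- by move=> v a w; rewrite linearZ.
- by move=> v; rewrite -sqr_normE lexx mulr_natl mulr2n ler_wpDl ?exprn_ge0.
Qed.

Lemma inner_product_prod_dot : inner_product_on (prod_dot dot).
Proof.
have [dotC dotD dotZ _] := inner_product_dot.
split; rewrite /prod_dot.
- by move=> v w; rewrite dotC [dot v.2 _]dotC.
- by move=> v w z /=; rewrite !dotD; ring.
- by move=> v a w /=; rewrite !dotZ mulrDr.
- move=> [v w]; rewrite [`|(v, w)|]prod_normE/= -!sqr_normE.
  have v0 := normr_ge0 v; have w0 := normr_ge0 w.
  have v2 := exprn_ge0 2 v0; have w2 := exprn_ge0 2 w0.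
  have [vw|wv] := leP `|v| `|w|.
    have : `|v| ^+ 2 <= `|w| ^+ 2 by rewrite ler_pXn2r.
    by move=> ?; apply/andP; split; lra.
  have : `|w| ^+ 2 <= `|v| ^+ 2 by rewrite ler_pXn2r// ltW.
  by move=> ?; apply/andP; split; lra.
Qed.

End HilbertNorm.

Section LipschitzGradient.
Variables (R : realType) (X : normedModType R) (dot : X -> X -> R).
Hypothesis dotP : inner_product_on dot.
Hypothesis hdot : forall x : X, `|x| = hnorm dot x.
Variables (g : X -> R) (gr : X -> X) (K : R).
Hypothesis g_grad : forall x, is_gradient dot g x (gr x).
Hypothesis gr_lip : forall x y, `|gr x - gr y| <= K * `|x - y|.

Lemma is_derive_line (x w : X) (t : R) :
  is_derive t 1 (fun s => g (x + s *: w)) (dot (gr (x + t *: w)) w).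
Proof.
have [dg gv] := g_grad (x + t *: w).
have dgw : derivable g (x + t *: w) w by exact: diff_derivable.
have E : (fun h => h^-1 *: (((fun s => g (x + s *: w)) \o shift t) (h *: 1)
             - g (x + t *: w))) =
         (fun h => h^-1 *: ((g \o shift (x + t *: w)) (h *: w)
             - g (x + t *: w))).
  apply/funext => h /=.
  by rewrite -[h%:A]/(h * 1) mulr1 scalerDl addrCA.
split; first by rewrite /derivable E.
by rewrite /derive E -gv -deriveE.
Qed.

(** Subtracting [K / 2 * t ^+ 2 * `|w| ^+ 2] makes the remainder nonincreasing
    along the segment from [x] to [x + w]; the sharp constant [K / 2] enters the
    bound on [lmax]. *)
Lemma descent_upper (x w : X) :
  g (x + w) - g x - dot (gr x) w <= K / 2 * `|w| ^+ 2.
Proof.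
have [dotC dotD dotZ _] := dotP.
pose G : R -> R := fun s => g (x + s *: w).
pose k := K / 2 * `|w| ^+ 2.
pose phi : R -> R := G - dot (gr x) w *: id - k *: (id ^+ 2).
pose dphi s := dot (gr (x + s *: w)) w - dot (gr x) w - k * (s *+ 2).
have dG (s : R) : is_derive s 1 G (dot (gr (x + s *: w)) w) := is_derive_line x w s.
have dphiE (s : R) : is_derive s 1 phi (dphi s).
  apply: is_derive_eq.
  by rewrite /dphi expr1 /GRing.scale/= !mulr1 mulr_natl.
have [|c /[!in_itv]/= /andP[c0 _]] :=
    @MVT _ phi dphi 0 1 ltr01 (fun s _ => dphiE s).
  apply: continuous_subspaceT => s.
  by apply: differentiable_continuous; apply/derivable1_diffP.
rewrite subr0 mulr1 => phiE.
have : dphi c <= 0.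
  rewrite /dphi.
  have -> : dot (gr (x + c *: w)) w - dot (gr x) w
            = dot (gr (x + c *: w) - gr x) w.
    rewrite dotC [dot (gr x) w]dotC [RHS]dotC -[- gr x]scaleN1r.
    by rewrite dotD dotZ mulN1r.
  have := cauchy_schwarz dotP (gr (x + c *: w) - gr x) w.
  rewrite -!hdot => /(le_trans (ler_norm _)).
  have := gr_lip (x + c *: w) x.
  rewrite [x + _ - x]addrAC subrr add0r normrZ gtr0_norm//.
  move=> /(ler_wpM2r (normr_ge0 w)) + h => /(le_trans h); rewrite /k.
  by rewrite -mulr_natr; lra.
rewrite -phiE /phi /G !fctE /= scale1r scale0r addr0 expr0n/= expr1n.
by rewrite /GRing.scale/= !mulr1 !mulr0 !subr0 -/k; lra.
Qed.

End LipschitzGradient.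

Section QuadraticExpansion.
Variables (R : realType) (X : normedModType R) (dot : X -> X -> R).
Hypothesis dotP : inner_product_on dot.
Hypothesis hdot : forall x : X, `|x| = hnorm dot x.
Variables (g : X -> R) (gr : X -> X) (K : R).
Hypothesis g_grad : forall x, is_gradient dot g x (gr x).
Hypothesis gr_lip : forall x y, `|gr x - gr y| <= K * `|x - y|.

(** The lower bound is the upper bound for [- g]. *)
Lemma descent (x w : X) :
  `|g (x + w) - g x - dot (gr x) w| <= K / 2 * `|w| ^+ 2.
Proof.
have [dotC _ dotZ _] := dotP.
rewrite ler_norml (descent_upper dotP hdot g_grad gr_lip) andbT.
have dotN v z : dot (- v) z = - dot v z.
  by rewrite dotC -scaleN1r dotZ mulN1r dotC.
have gN_grad z : is_gradient dot (- g) z (- gr z).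
  have [dg gv] := g_grad z.
  by split; [exact: differentiableN|move=> v; rewrite diffN// fctE gv dotN].
have grN_lip y z : `|- gr y - - gr z| <= K * `|y - z|.
  by rewrite -opprD normrN.
have := descent_upper dotP hdot gN_grad grN_lip x w.
by rewrite dotN !fctE; lra.
Qed.

End QuadraticExpansion.

(** * Convex functions and desingularizing functions *)

(** Chords from [x] towards [y] have slopes at most [g y - g x]; the directional
    derivative is their limit. *)
Lemma convex_derive_le (R : realType) (V : normedModType R)
    (D : set (convex_lmodType V)) (g : V -> R) (x y : V) :
  convex_function D g -> D x -> D y -> derivable g x (y - x) ->
  'D_(y - x) g x <= g y - g x.
Proof.
move=> gconv Dx Dy /cvg_ex[l gl].
have -> : 'D_(y - x) g x = l by exact: cvg_lim gl.
have {}gl : h^-1 *: ((g \o shift x) (h *: (y - x)) - g x) @[h --> 0^'+] --> l.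
  apply: cvg_trans gl; apply: cvg_app => A [e e0 eA].
  by exists e => // h he h0; apply: eA => //; rewrite gt_eqF.
refine (cvgr_to_le gl _).
near=> h.

have h0 : 0 < h by near: h; exact: nbhs_right_gt.
have h1 : h <= 1 by near: h; exact: nbhs_right_le ltr01.
rewrite /GRing.scale/= ler_pdivrMl//.
have := gconv (Itv01 (ltW h0) h1) y x (mem_set Dy) (mem_set Dx).
rewrite convRE/= /conv/= /unstable.onem.
have -> : h *: y + (1 - h) *: x = h *: (y - x) + x.
  by rewrite scalerBl scale1r scalerBr addrAC addrA.
by lra.
Unshelve. all: by end_near. Qed.

Lemma convex_gradient_le (R : realType) (X : normedModType R)
    (dot : X -> X -> R) (g : X -> R) (x v y : X) :
  convex_function [set: convex_lmodType X] g -> is_gradient dot g x v ->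
  dot v (y - x) <= g y - g x.
Proof.
move=> gconv [dg gv]; rewrite -gv -deriveE//.
by apply: convex_derive_le gconv _ _ _ => //; exact: diff_derivable.
Qed.

Section Desingularizing.
Variables (R : realType) (nu : \bar R) (psi : R -> R).
Hypothesis psiP : desingularizing nu psi.

(** A concave function lies below its tangents: this is what makes the drop of
    [psi] control the drop of its argument. *)
Lemma desingularizing_derive_le (s t : R) :
  0 <= s -> s <= t -> 0 < t -> (t%:E < nu)%E ->
  derive1 psi t * (t - s) <= psi t - psi s.
Proof.
move=> s0 st t0 tnu; have [_ _ _ psi_conc psi_der] := psiP.
have [dpsi _ _] := psi_der t t0 tnu.
have dp : differentiable psi t by exact/derivable1_diffP.
have Dpsi : 'D_(s - t) psi t = derive1 psi t * (s - t).
  by rewrite (deriveE (s - t) dp) (deriv1E dpsi) [LHS]mulrC.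
have dst : derivable psi t (s - t) by exact: diff_derivable dp.
have Ds : 0 <= s /\ (s%:E < nu)%E.
  by split=> //; apply: le_lt_trans tnu; rewrite lee_fin.
have := convex_derive_le psi_conc (conj (ltW t0) tnu) Ds (derivableN dst).
by rewrite (deriveN dst) Dpsi; lra.
Qed.

Lemma desingularizing_cvg0 (t : nat -> R) : (0 < nu)%E ->
  (forall k, 0 <= t k) -> t @ \oo --> (0 : R) -> psi \o t @ \oo --> (0 : R).
Proof.
move=> nu0 t0 tc; have [_ psi0 psic _ _] := psiP.
have tnu : \forall k \near \oo, ((t k)%:E < nu)%E.
  case: (nu) nu0 => [r|_|]//=; last by apply: nearW => k; exact: ltry.
  by rewrite lte_fin => r0; near do rewrite lte_fin; exact: cvgr_lt tc _ r0.
have /subspace_continuousP/(_ 0 (conj (lexx 0) nu0)) psi_right0 := psic.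
rewrite -psi0; apply: cvg_trans psi_right0.
move=> A psiA; apply: filterS2 tnu (tc _ psiA) => k tk.
by apply.
Unshelve. all: by end_near. Qed.

End Desingularizing.

(** * Sequences of finite length *)

Section FiniteLength.
Variables (R : realType) (X : normedModType R).
Variables (u : nat -> X) (ustar : X) (phi : nat -> R) (C rho : R) (N0 : nat).

Let a n := `|u n.+1 - u n|.

Hypothesis C_ge0 : 0 <= C.
Hypothesis phi_ge0 : forall n, (N0 <= n)%N -> 0 <= phi n.
Hypothesis step_le : forall n, (N0 <= n)%N ->
  `|u n.+1 - ustar| < rho -> `|u n.+2 - ustar| < rho ->
  4 * a n.+2 <= a n.+1 + a n + C * (phi n.+1 - phi n.+2).

(** The recursion [step_le] says that [energy] drops by at least [2 * a n.+2] at
    each step, which pays for moving from [u n.+2] to [u n.+3] in [radius]. So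
    [radius] is nonincreasing while it is below [rho], and it bounds the distance
    of the iterates to [ustar]: once small, it keeps them inside the ball. *)
Let energy n := 2 * a n.+1 + a n + C * phi n.+1.
Let radius n := 2 * `|u n.+2 - ustar| + energy n.

Let a_ge0 n : 0 <= a n. Proof. exact: normr_ge0. Qed.

Let energy_ge0 n : (N0 <= n)%N -> 0 <= energy n.
Proof. by move=> /leqW Nn; rewrite !addr_ge0 ?mulr_ge0 ?phi_ge0. Qed.

Let dist_le_radius n : (N0 <= n)%N ->
  `|u n.+1 - ustar| <= radius n /\ `|u n.+2 - ustar| <= radius n.
Proof.
move=> /leqW Nn.
have h1 : `|u n.+1 - ustar| <= `|u n.+2 - ustar| + a n.+1.
  by rewrite /a [leRHS]addrC [`|u n.+2 - u _|]distrC; apply: ler_distD.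
have h2 := normr_ge0 (u n.+2 - ustar); have h3 := a_ge0 n.
have h4 := a_ge0 n.+1; have h5 := mulr_ge0 C_ge0 (phi_ge0 Nn).
by rewrite /radius /energy; split; lra.
Qed.

Let energy_step n : (N0 <= n)%N -> radius n < rho ->
  energy n.+1 + 2 * a n.+2 <= energy n /\ radius n.+1 <= radius n.
Proof.
move=> Nn nrho; have [d1 d2] := dist_le_radius Nn.
have := step_le Nn (le_lt_trans d1 nrho) (le_lt_trans d2 nrho).
have : `|u n.+3 - ustar| <= a n.+2 + `|u n.+2 - ustar| by apply: ler_distD.
by rewrite /radius /energy; split; lra.
Qed.

Let trapped n k : (N0 <= n)%N -> radius n < rho ->
  radius (n + k) <= radius n /\
  2 * (\sum_(0 <= j < k) a (n + j).+2) + energy (n + k) <= energy n.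
Proof.
move=> Nn nrho; elim: k => [|k [IHr IHe]].
  by rewrite addn0 big_nil mulr0 add0r.
have [he hr] := energy_step (leq_trans Nn (leq_addr k n)) (le_lt_trans IHr nrho).
by rewrite addnS big_nat_recr//=; split; lra.
Qed.

Hypothesis rho_gt0 : 0 < rho.
Hypothesis u_cluster : forall e : R, 0 < e ->
  forall N, exists2 n, (N <= n)%N & `|u n - ustar| < e.
Hypothesis a_cvg0 : a @ \oo --> (0 : R).
Hypothesis phi_cvg0 : phi @ \oo --> (0 : R).

Let radius_small (e : R) : 0 < e -> exists2 n, (N0 <= n)%N & radius n < e.
Proof.
move=> e0; pose d := e / (6 + C).
have C6 : 0 < 6 + C by rewrite ltr_wpDr.
have d0 : 0 < d by rewrite divr_gt0.
(* [radius n] has three step lengths, two distances and [C] values of [phi] to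
   bound: [6 + C] leaves room for strictness. *)
have [Na _ aN] : \forall n \near \oo, a n < d by exact: cvgr_lt a_cvg0 _ d0.
have [Np _ pN] : \forall n \near \oo, phi n < d by exact: cvgr_lt phi_cvg0 _ d0.
have [[|[|n]]] := u_cluster d0 (maxn N0 (maxn Na Np)).+2; rewrite ?ltnS//.
rewrite !geq_max => /and3P[h0 ha hp] un; exists n => //.
have h1 := aN _ ha; have h2 := aN _ (leqW ha).
have h3 := ler_wpM2l C_ge0 (ltW (pN _ (leqW hp))).
have : e = (6 + C) * d by rewrite mulrC divfK// gt_eqF.
move: h1 h2 h3; rewrite /radius /energy /=; lra.
Qed.

Lemma finite_length_cvg : u @ \oo --> ustar.
Proof.
apply/cvgrPdist_le => e e0.
have [|n Nn nr] := @radius_small (Num.min e rho); first by rewrite lt_min e0.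
move: nr; rewrite lt_min => /andP[ne nrho].
exists n.+1 => // -[//|m] /= nm.
rewrite distrC -(subnKC (nm : (n <= m)%N)).
apply: le_trans (dist_le_radius (leq_trans Nn (leq_addr _ _))).1 _.
exact: le_trans (trapped _ Nn nrho).1 (ltW ne).
Qed.

Lemma finite_length_sum : (\sum_(0 <= n <oo) (a n)%:E < +oo)%E.
Proof.
have [n Nn nrho] := radius_small rho_gt0.
have a0 k : (0 <= k)%N -> xpredT k -> (0 <= (a k)%:E)%E by rewrite lee_fin.
apply: (@le_lt_trans _ _
    (\sum_(0 <= k < n.+2) a k + energy n)%:E); last exact: ltry.
apply: lime_le; first exact: is_cvg_nneseries.
apply: nearW => k; rewrite sumEFin lee_fin.
apply: (@le_trans _ _ (\sum_(0 <= j < n.+2 + k) a j)).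
  rewrite [leRHS](@big_cat_nat _ _ _ k)//= ?leq_addl//.
  by rewrite lerDl sumr_ge0.
rewrite (@big_cat_nat _ _ _ n.+2)//= ?leq_addr//.
rewrite lerD2l -{1}[n.+2]add0n big_addn addKn.
under eq_bigr do rewrite addnC !addSn.
have [_ h] := trapped k Nn nrho.
have := energy_ge0 (leq_trans Nn (leq_addr k n)).
have : 0 <= \sum_(0 <= j < k) a (n + j).+2 by exact: sumr_ge0.
move: h; lra.
Qed.

End FiniteLength.

(** * One step of the algorithm *)

(** Tested at [t = - b / (2 * k)] with [k = `|c| + 1]. *)
Lemma vanishing_first_order (R : realType) (b c : R) :
  (forall t, 0 <= t * b + t ^+ 2 * c) -> b = 0.
Proof.
move=> h; pose k := `|c| + 1; have k0 : 0 < k by rewrite ltr_wpDl.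
have := h (- b / k / 2).
have ck : c <= k by rewrite ler_wpDr// ler_norm.
have t2 : 0 <= (- b / k / 2) ^+ 2 by rewrite sqr_ge0.
move=> /le_trans/(_ (lerD (lexx _) (ler_wpM2l t2 ck))).
have -> : - b / k / 2 * b + (- b / k / 2) ^+ 2 * k = - (b ^+ 2 / k / 4).
  by field; rewrite gt_eqF.
rewrite oppr_ge0 -mulrA pmulr_lle0 ?mulr_gt0 ?invr_gt0// => b2.
by apply/eqP; rewrite -sqrf_eq0 eq_le b2 sqr_ge0.
Qed.

Section Step.
Variables (R : realType) (X : normedModType R) (dot : {dot X for idfun}).
Hypothesis hdot : forall x : X, `|x| = hnorm dot x.
Variables (H F : X -> R) (h f : X -> X) (M : {linear X -> X}).
Variables (L Lh dt : R).
Hypothesis H_convex : convex_function [set: convex_lmodType X] H.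
Hypothesis H_grad : forall x, is_gradient dot H x (h x).
Hypothesis F_grad : forall x, is_gradient dot F x (f x).
Hypothesis h_lip : forall x y, `|h x - h y| <= Lh * `|x - y|.
Hypothesis f_lip : forall x y, `|f x - f y| <= L * `|x - y|.
Hypothesis M_sym : forall x z, dot (M x) z = dot x (M z).
Hypothesis M_ge0 : forall x, 0 <= dot (M x) x.
Hypothesis dt_gt0 : 0 < dt.
Hypothesis L_ge0 : 0 <= L.
Hypothesis Lh_ge0 : 0 <= Lh.

Let dotP : inner_product_on dot := inner_product_dot hdot.
Let dotC v w : dot v w = dot w v. Proof. by case: dotP. Qed.
Let dotDr v w z : dot v (w + z) = dot v w + dot v z.
Proof. by case: dotP. Qed.
Let dotZr v a w : dot v (a *: w) = a * dot v w.
Proof. by case: dotP. Qed.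
Let dotNr v w : dot v (- w) = - dot v w.
Proof. by rewrite -scaleN1r dotZr mulN1r. Qed.
Let dotDl v w z : dot (v + w) z = dot v z + dot w z.
Proof. by rewrite dotC dotDr !(dotC z). Qed.
Let dotZl v a w : dot (a *: v) w = a * dot v w.
Proof. by rewrite dotC dotZr dotC. Qed.
Let dotNl v w : dot (- v) w = - dot v w.
Proof. by rewrite dotC dotNr dotC. Qed.
Let dotE := (dotDr, dotDl, dotNr, dotNl, dotZr, dotZl).

Let normD2 (v w : X) : `|v + w| ^+ 2 = `|v| ^+ 2 + 2 * dot v w + `|w| ^+ 2.
Proof. by rewrite !(sqr_normE hdot) !dotE (dotC w); ring. Qed.

Let normZ2 (a : R) (v : X) : `|a *: v| ^+ 2 = a ^+ 2 * `|v| ^+ 2.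
Proof. by rewrite normrZ exprMn real_normK ?num_real. Qed.

Let dot_le (v w : X) : `|dot v w| <= `|v| * `|w|.
Proof. by rewrite !hdot; exact: cauchy_schwarz. Qed.

Let H_expand := descent dotP hdot H_grad h_lip.
Let F_expand := descent dotP hdot F_grad f_lip.

Lemma gradient_Fn un up : gradient dot (Fn dot F f dt un up) un =
  (2 * (3 * dt)^-1) *: (un - up) - f un - (f un - f up).
Proof.
apply: (gradient_eq dotP).
apply: (is_gradient_quadratic dotP (C := (3 * dt)^-1 + L / 2)) => w.
rewrite /Fn [un + w - up]addrAC (normD2 (un - up)) !dotE.
have := F_expand un w; set r := (3 * dt)^-1.
have r0 : 0 < r by rewrite invr_gt0 mulr_gt0.
have w2 : 0 <= r * `|w| ^+ 2.
  exact: mulr_ge0 (ltW r0) (exprn_ge0 _ (normr_ge0 _)).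
by rewrite !ler_norml => /andP[? ?]; apply/andP; split; lra.
Qed.

Section Iterate.
Variables (un up yn : X).
Let d := yn - un.
Let s := un - up.
Let df := f un - f up.
Let r := (3 * dt)^-1.

Hypothesis yn_min : forall v,
  subproblem dot H F f M dt un up yn <= subproblem dot H F f M dt un up v.

(** Along [yn + t *: z] the objective changes by [t] times the inner product of
    [z] with the difference of the two sides, up to [O(t ^+ 2)]; minimality at
    [yn] makes this inner product vanish for every [z]. *)
Lemma subproblem_optimality :
  h yn = (2 * r) *: s - f un - df - (2 / dt) *: d - M d.
Proof.
set G := (2 * r) *: s - f un - df.
apply/eqP; rewrite -subr_eq0; apply/eqP/(dot_eq dotP) => z.
rewrite [RHS]dotC [RHS](linear0 (dot z)).
apply: (@vanishing_first_order _ _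
  (Lh / 2 * `|z| ^+ 2 + dt^-1 * `|z| ^+ 2 + 2^-1 * dot (M z) z)) => t.
have := yn_min (yn + t *: z).
rewrite /subproblem gradient_Fn -/r -/s -/df -/G /Hn [yn + _ - un]addrAC -/d.
have -> : M (d + t *: z) = M d + t *: M z by rewrite linearD linearZ.
have : t * dot (M z) d = t * dot (M d) z by rewrite M_sym dotC.
rewrite (normD2 d) normZ2 !dotE.
have := H_expand yn (t *: z); rewrite normZ2 dotZr ler_norml => /andP[_].
lra.
Qed.

(** Convexity of [H], used at [yn] towards [un], combined with the optimality
    condition yields the strong convexity gain [2 / dt * `|d| ^+ 2], of which
    [Hn] itself gives back [dt^-1 * `|d| ^+ 2]. The part [- Fn] gains
    [r * `|d| ^+ 2] and loses at most the curvature [L / 2 * `|d| ^+ 2] of [F].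
    As [dt^-1 = 3 * r], the balance is [4 * r - L / 2]. *)
Lemma En_decrease :
  En dot H F f dt un up yn <=
  En dot H F f dt un up un - (4 * r - L / 2) * `|d| ^+ 2.
Proof.
have cvx := convex_gradient_le un H_convex (H_grad yn).
have := F_expand un d; rewrite ler_norml => /andP[_].
rewrite {1}/d [un + _]addrC subrK.
move: cvx; rewrite -[un - yn]opprB -/d subproblem_optimality !dotE.
have := M_ge0 d.
rewrite /En /Hn /Fn -/r -/s -/df subrr normr0 -/d.
have -> : yn - up = d + s by rewrite /d /s addrA subrK.
have dtE : dt^-1 = 3 * r by rewrite /r; field; rewrite gt_eqF.
rewrite dtE expr0n/= !(sqr_normE hdot) !dotE (dotC yn un) (dotC up un).
rewrite (dotC up yn).
lra.
Qed.

(** In [En un up un1 <= En un up un - q * `|d| ^+ 2] the terms that mix the steps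
    [s1 = un1 - un] and [s = un - up] are [2 * r * dot s1 s - dot df s1], at most
    [K * (`|s1| ^+ 2 + `|s| ^+ 2)] with [K = L / 2 + r]. The part in [`|s|]
    joins the potential before the step, the part in [`|s1|] costs
    [L * `|s1| ^+ 2] once the potential after the step is formed. *)
Lemma potential_decrease (alpha lam lmax : R) (un1 : X) :
  0 <= alpha -> 0 <= lam <= lmax -> 0 <= 4 * r - L / 2 ->
  un1 = yn + lam *: d -> MPCLS_ok dot H F f dt alpha un up yn lam ->
  potential H F L dt (un1, un)
    + ((4 * r - L / 2) / (1 + lmax) ^+ 2 - L) * `|un1 - un| ^+ 2
  <= potential H F L dt (un, up).
Proof.
move=> alpha0 /andP[lam0 laml] q0 un1E; rewrite /MPCLS_ok -/d -un1E => ok.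
have s1E : un1 - un = (1 + lam) *: d.
  by rewrite un1E scalerDl scale1r addrAC.
have lam1 : 0 < 1 + lam by rewrite ltr_wpDr.
have d2_ge : `|un1 - un| ^+ 2 / (1 + lmax) ^+ 2 <= `|d| ^+ 2.
  rewrite s1E normZ2 mulrAC ler_piMl ?exprn_ge0//.
  rewrite ler_pdivrMr ?exprn_gt0//; last by lra.
  by rewrite mul1r ler_pXn2r ?nnegrE//; lra.
have {d2_ge} := ler_wpM2l q0 d2_ge.
have : En dot H F f dt un up un1 <=
    En dot H F f dt un up un - (4 * r - L / 2) * `|d| ^+ 2.
  apply: le_trans En_decrease; apply: (le_trans ok).
  by rewrite gerBl !mulr_ge0 ?exprn_ge0.
rewrite /potential /= /En /Hn /Fn -/r -/s -/df subrr normr0 expr0n/=.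
set s1 := un1 - un.
have -> : un1 - up = s1 + s by rewrite /s1 /s addrA subrK.
have dtE : dt^-1 = 3 * r by rewrite /r; field; rewrite gt_eqF.
have r0 : 0 < r by rewrite invr_gt0 mulr_gt0.
rewrite (normD2 s1 s) (dotDr df s1 s) dtE.
have cross : 2 * dot s1 s <= `|s1| ^+ 2 + `|s| ^+ 2.
  have := exprn_ge0 2 (normr_ge0 (s1 - s)).
  by rewrite (normD2 s1) dotNr normrN; lra.
have := ler_wpM2l (ltW r0) cross.
have df_le : - dot df s1 <= L / 2 * (`|s1| ^+ 2 + `|s| ^+ 2).
  have df_s : `|df| <= L * `|s| := f_lip un up.
  have n1 := normr_ge0 s1; have n2 := normr_ge0 s.
  apply: (le_trans (ler_norm _)); rewrite normrN (le_trans (dot_le _ _))//.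
  apply: (le_trans (ler_wpM2r n1 df_s)).
  have : 0 <= L * (`|s1| - `|s|) ^+ 2.
    by rewrite mulr_ge0 ?sqr_ge0.
  by lra.
lra.
Qed.

(** Replacing [h yn] by its value from the optimality condition leaves only
    increments of [h] and [f] and terms linear in [d] and [s]; moreover [d] and
    [un1 - yn] are both at most as long as [un1 - un]. *)
Lemma gradE_bound (lam CM : R) (un1 : X) :
  0 <= CM -> 0 <= lam -> (forall x, `|M x| <= CM * `|x|) ->
  un1 = yn + lam *: d ->
  `|h un1 + f un1| <=
  (Lh + L + 2 / dt + CM + 2 * r) * (`|un1 - un| + `|un - up|).
Proof.
move=> CM0 lam0 MC un1E.
have s1E : un1 - un = (1 + lam) *: d.
  by rewrite un1E scalerDl scale1r addrAC.
have r0 : 0 < r by rewrite invr_gt0 mulr_gt0.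
have dti : 0 < dt^-1 by rewrite invr_gt0.
have regroup (h1 h0 f1 f0 p q z v : X) : h0 = v - f0 - p - q - z ->
    h1 + f1 = (h1 - h0) + (f1 - f0) - p - q - z + v.
  move=> ->; rewrite !opprD !opprK !addrA [RHS](ACl (1*7*12*2*3*8*4*9*5*10*6*11)).
  by rewrite /= !addrK.
rewrite (regroup _ _ _ _ _ _ _ _ subproblem_optimality).
have tri (v w : X) (x y : R) : `|v| <= x -> `|w| <= y -> `|v + w| <= x + y.
  by move=> vx wy; apply: le_trans (ler_normD _ _) (lerD vx wy).
have ld : `|un1 - yn| = lam * `|d|.
  by rewrite un1E addrC addKr normrZ ger0_norm.
have s1d : `|un1 - un| = `|d| + lam * `|d|.
  by rewrite s1E normrZ ger0_norm ?mulrDl ?mul1r// addr_ge0.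
have d0 := normr_ge0 d; have s0 := normr_ge0 s.
have ld0 := mulr_ge0 lam0 d0.
have n1 : `|h un1 - h yn| <= Lh * (lam * `|d|) by rewrite -ld.
have n2 : `|f un1 - f un| <= L * (`|d| + lam * `|d|) by rewrite -s1d.
have n3 : `|- df| <= L * `|s| by rewrite normrN; exact: f_lip.
have n4 : `|- ((2 / dt) *: d)| <= 2 / dt * `|d|.
  by rewrite normrN normrZ ger0_norm// divr_ge0// ltW.
have n5 : `|- M d| <= CM * `|d| by rewrite normrN.
have n6 : `|(2 * r) *: s| <= 2 * r * `|s|.
  by rewrite normrZ ger0_norm// mulr_ge0// ltW.
apply: (le_trans (tri _ _ _ _ (tri _ _ _ _ (tri _ _ _ _ (tri _ _ _ _
  (tri _ _ _ _ n1 n2) n3) n4) n5) n6)).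
rewrite s1d -/s; set x := `|d|; set y := lam * x; set z := `|s|.
have [p1 p2] := (mulr_ge0 Lh_ge0 d0, mulr_ge0 Lh_ge0 s0).
have [p3 p4] := (mulr_ge0 (ltW dti) ld0, mulr_ge0 (ltW dti) s0).
have [p5 p6] := (mulr_ge0 CM0 ld0, mulr_ge0 CM0 s0).
have [p7 p8] := (mulr_ge0 (ltW r0) d0, mulr_ge0 (ltW r0) ld0).
by rewrite -/x -/y -/z in p1 p2 p3 p4 p5 p6 p7 p8 *; lra.
Qed.

End Iterate.

Let K := L / 2 + (3 * dt)^-1.

Let K_ge0 : 0 <= K.
Proof. by rewrite addr_ge0 ?divr_ge0 ?invr_ge0 ?mulr_ge0 ?(ltW dt_gt0). Qed.

Lemma is_gradient_potential x y :
  is_gradient (prod_dot dot) (potential H F L dt) (x, y)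
    (h x + f x + (2 * K) *: (x - y), - (2 * K) *: (x - y)).
Proof.
apply: (is_gradient_quadratic (inner_product_prod_dot hdot)
  (C := Lh / 2 + L / 2 + 4 * K)) => -[v w].
rewrite /potential /prod_dot /= -/K.
have vN : `|v| <= `|(v, w)| by rewrite [leRHS]prod_normE/= le_max lexx.
have wN : `|w| <= `|(v, w)| by rewrite [leRHS]prod_normE/= le_max lexx orbT.
have v2 : `|v| ^+ 2 <= `|(v, w)| ^+ 2 by rewrite ler_pXn2r ?nnegrE.
have w2 : `|w| ^+ 2 <= `|(v, w)| ^+ 2 by rewrite ler_pXn2r ?nnegrE.
have vw2 : 0 <= `|v - w| ^+ 2 <= 2 * (`|v| ^+ 2 + `|w| ^+ 2).
  rewrite exprn_ge0//=; have := exprn_ge0 2 (normr_ge0 (v + w)).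
  by rewrite !normD2 dotNr normrN; lra.
have -> : x + v - (y + w) = (x - y) + (v - w) by rewrite opprD addrACA.
rewrite (normD2 (x - y)) !dotE.
move: vw2 => /andP[/(ler_wpM2l K_ge0) vw0 /(ler_wpM2l K_ge0) vw2].
have := ler_wpM2l K_ge0 v2; have := ler_wpM2l K_ge0 w2.
have Lh2 : 0 <= Lh / 2 by rewrite divr_ge0.
have L2 : 0 <= L / 2 by rewrite divr_ge0.
have := ler_wpM2l Lh2 v2; have := ler_wpM2l L2 v2.
have := H_expand x v; have := F_expand x v; rewrite !ler_norml.
by move=> /andP[? ?] /andP[? ?] *; apply/andP; split; lra.
Qed.

Lemma gradient_potential_norm_le x y :
  hnorm (prod_dot dot) (gradient (prod_dot dot) (potential H F L dt) (x, y))
  <= `|h x + f x| + 4 * K * `|x - y|.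
Proof.
rewrite (gradient_eq (inner_product_prod_dot hdot) (is_gradient_potential x y)).
set g := _ + _; set v := (2 * K) *: (x - y).
have gE : `|g| <= `|h x + f x| + 2 * K * `|x - y|.
  rewrite (le_trans (ler_normD _ _))// normrZ ger0_norm ?lexx// mulr_ge0//.
rewrite /hnorm /prod_dot /= -!(sqr_normE hdot) normrZ normrN ger0_norm; last first.
  by rewrite mulr_ge0.
have vE : 0 <= 2 * K * `|x - y| by rewrite !mulr_ge0.
apply: (@le_trans _ _ (`|g| + 2 * K * `|x - y|)); last lra.
rewrite -(@ler_pXn2r _ 2) ?nnegrE ?sqrtr_ge0 ?addr_ge0//.
rewrite sqr_sqrtr ?addr_ge0 ?sqr_ge0// sqrrD.
by rewrite -addrA (addrC (_ *+ 2)) addrA lerDl mulrn_wge0 // mulr_ge0.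
Qed.

End Step.

(** * Descent sequences of a KL function *)

(** The arithmetic-geometric mean inequality for [b] and [y]. *)
Lemma four_mul_le (R : realType) (a b y : R) :
  0 <= b -> 0 <= y -> 4 * a ^+ 2 <= b * y -> 4 * a <= b + y.
Proof.
move=> b0 y0 aby; apply: (le_trans (ler_norm _)).
rewrite -(@ler_pXn2r _ 2) ?nnegrE ?addr_ge0//.
rewrite real_normK ?num_real//.
by have := sqr_ge0 (b - y); lra.
Qed.

(** The distance from 0 to the subdifferential is at most the norm of any of its
    elements, in particular of the gradient. *)
Lemma KL_smooth (R : realType) (Y : normedModType R) (dot : Y -> Y -> R)
    (g : Y -> R) (gr : Y -> Y) (x : Y) :
  inner_product_on dot -> (forall z, is_gradient dot g z (gr z)) -> gr x = 0 ->
  KL_function dot (fun z => (g z)%:E) ->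
  exists (nu : \bar R) (psi : R -> R), [/\ (0 < nu)%E, desingularizing nu psi &
    \forall z \near x, g x < g z -> ((g z - g x)%:E < nu)%E ->
      1 <= derive1 psi (g z - g x) * hnorm dot (gr z)].
Proof.
move=> dotP g_grad grx0 [_ _] /(_ x).
rewrite -{1}grx0 => /(_ (is_gradient_limiting_subdiff dotP (g_grad x))).
move=> [nu [psi [nu0 psiP KL]]]; exists nu, psi; split=> //.
apply: filterS KL => z KLz gxz gz_nu.
have [_ _ _ _ /(_ (g z - g x))] := psiP.
rewrite subr_gt0 => /(_ gxz gz_nu)[_ _ dpsi_gt0].
rewrite -lee_fin; apply: le_trans (KLz _ _) _.
- by rewrite lte_fin.
- move: gz_nu; case: (nu) => [r| |]//=; rewrite ?ltry//.
  by rewrite !lte_fin ltrBlDl.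
rewrite -EFinB /= EFinM; apply: lee_wpmul2l; first by rewrite lee_fin ltW.
apply: ereal_inf_lbound; exists (gr z) => //.
exact: is_gradient_limiting_subdiff.
Qed.

Section DescentSequence.
Variables (R : realType) (X : finNormedModType R) (dot : {dot X for idfun}).
Hypothesis hdot : forall x : X, `|x| = hnorm dot x.
Variables (E : X -> R) (gE : X -> X) (gA : X * X -> X * X) (KE K : R).
Let A (z : X * X) := E z.1 + K * `|z.1 - z.2| ^+ 2.
Hypothesis E_grad : forall x, is_gradient dot E x (gE x).
Hypothesis gE_lip : forall x y, `|gE x - gE y| <= KE * `|x - y|.
Hypothesis E_level : forall r : R, bounded_set [set x | E x <= r].
Hypothesis K_ge0 : 0 <= K.
Hypothesis A_grad : forall z, is_gradient (prod_dot dot) A z (gA z).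
Hypothesis gA_le : forall z,
  hnorm (prod_dot dot) (gA z) <= `|gE z.1| + 4 * K * `|z.1 - z.2|.
Hypothesis A_KL : KL_function (prod_dot dot) (fun z => (A z)%:E).

Variables (u : nat -> X) (c C : R).
Let a n := `|u n.+1 - u n|.
Let pot n := A (u n.+1, u n).
Hypothesis c_gt0 : 0 < c.
Hypothesis C_ge0 : 0 <= C.
Hypothesis decrease : forall n, pot n.+1 + c * a n.+1 ^+ 2 <= pot n.
Hypothesis relative_error : forall n, `|gE (u n.+2)| <= C * (a n.+1 + a n).

Let a_ge0 n : 0 <= a n. Proof. exact: normr_ge0. Qed.

Let dotP := inner_product_dot hdot.

Lemma pot_nonincreasing : nonincreasing_seq pot.
Proof.
apply/nonincreasing_seqP => n; have := decrease n.
by have := mulr_ge0 (ltW c_gt0) (sqr_ge0 (a n.+1)); lra.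
Qed.

Let E_le_pot n : E (u n.+1) <= pot n.
Proof. by rewrite /pot /A/= lerDl mulr_ge0 ?exprn_ge0. Qed.

Lemma descent_seq_bounded : exists B, forall n, `|u n| <= B.
Proof.
have [B [_ /(_ (B + 1))]] := E_level (pot 0).
rewrite ltrDl => /(_ ltr01) uB.
exists (Num.max `|u 0%N| (B + 1)) => -[|n]; rewrite le_max ?lexx//.
apply/orP; right; apply: uB => /=.
exact: le_trans (E_le_pot n) (pot_nonincreasing (leq0n n)).
Qed.

(** [E] has a quadratic minorant at 0, so it is bounded below on the ball that
    contains the iterates, and [pot] dominates [E]. *)
Lemma pot_cvg : exists2 zeta, pot @ \oo --> zeta & forall n, zeta <= pot n.
Proof.
have [B uB] := descent_seq_bounded.
have B0 : 0 <= B by exact: le_trans (uB 0%N).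
have pot_lb : has_lbound (range pot).
  exists (E 0 - `|gE 0| * B - `|KE / 2| * B ^+ 2) => _ [n _ <-].
  apply: le_trans (E_le_pot n).
  have := descent dotP hdot E_grad gE_lip 0 (u n.+1); rewrite add0r.
  have : `|dot (gE 0) (u n.+1)| <= `|gE 0| * B.
    apply: le_trans (cauchy_schwarz dotP _ _) _.
    by rewrite -!hdot ler_wpM2l.
  have : KE / 2 * `|u n.+1| ^+ 2 <= `|KE / 2| * B ^+ 2.
    apply: (@le_trans _ _ (`|KE / 2| * `|u n.+1| ^+ 2)).
      by rewrite ler_wpM2r ?exprn_ge0 ?ler_norm.
    by rewrite ler_wpM2l// ler_pXn2r ?nnegrE.
  by rewrite !ler_norml => ? /andP[? ?] /andP[? ?]; lra.
exists (inf (range pot)).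
  exact: nonincreasing_cvgn pot_nonincreasing pot_lb.
by move=> n; apply: ge_inf => //; exists n.
Qed.

Lemma step_cvg0 : a @ \oo --> (0 : R).
Proof.
have [zeta potz _] := pot_cvg.
apply/cvgrPdist_le => e e0.
have ce : 0 < c * e ^+ 2 by rewrite mulr_gt0 ?exprn_gt0.
have : (pot n - pot n.+1) @[n --> \oo] --> (zeta - zeta).
  by apply: cvgB => //; rewrite (cvg_shiftS pot).
rewrite subrr => /cvgr_lt/(_ _ ce)[N _ potN].
exists N.+1 => // -[//|n] /= Nn.
rewrite sub0r normrN ger0_norm// -(@ler_pXn2r _ 2) ?nnegrE ?(ltW e0)//.
rewrite -(ler_pM2l c_gt0).
by have := potN n Nn; have := decrease n; rewrite /=; lra.
Qed.

Lemma gA_seq_le n :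
  hnorm (prod_dot dot) (gA (u n.+2, u n.+1)) <= (C + 4 * K) * (a n.+1 + a n).
Proof.
apply: le_trans (gA_le _) _ => /=; have := relative_error n.
by have := mulr_ge0 K_ge0 (a_ge0 n); rewrite -/(a n.+1); lra.
Qed.

Lemma gA_seq_cvg0 :
  hnorm (prod_dot dot) (gA (u n.+1, u n)) @[n --> \oo] --> (0 : R).
Proof.
have a1 : a n.+1 @[n --> \oo] --> (0 : R).
  by rewrite (cvg_shiftS a); exact: step_cvg0.
have : (C + 4 * K) * (a n.+1 + a n) @[n --> \oo] --> (C + 4 * K) * (0 + 0).
  by apply: cvgM; [exact: cvg_cst|exact: cvgD a1 step_cvg0].
rewrite addr0 mulr0 => bound0.
have gA0 : hnorm (prod_dot dot) (gA (u n.+2, u n.+1)) @[n --> \oo] --> (0 : R).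
  apply: squeeze_cvgr (cvg_cst 0) bound0; apply: nearW => n.
  by rewrite sqrtr_ge0; exact: gA_seq_le.
by move: gA0; rewrite (cvg_shiftS (fun n => hnorm _ (gA (u n.+1, u n)))).
Qed.

(** Along a subsequence tending to [x] the steps vanish, so [pot] tends to
    [A (x, x) = E x] and the gradients to [gE x]. *)
Lemma cluster_critical x zeta : pot @ \oo --> zeta ->
  (forall e : R, 0 < e -> forall N, exists2 n, (N <= n)%N & `|u n - x| < e) ->
  E x = zeta /\ gE x = 0.
Proof.
move=> potz ux.
have Ec : {for x, continuous E}.
  by apply: differentiable_continuous; case: (E_grad x).
split.
  apply/eqP; rewrite -subr_eq0 -normr_le0; apply/ler_addgt0Pl => e e0.
  rewrite addr0.
  have e3 : 0 < e / 3 by rewrite divr_gt0.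
  have /cvgrPdist_lt/(_ _ e3) := Ec; rewrite -nbhs_nearE => /nbhs_ballP[d /= d0 Ed].
  have [N1 _ zN] : \forall n \near \oo, `|zeta - pot n| < e / 3.
    by move/cvgrPdist_lt: potz; exact.
  have Ka : K * a n ^+ 2 @[n --> \oo] --> (0 : R).
    have : K * a n ^+ 2 @[n --> \oo] --> K * (0 * 0).
      by apply: cvgM; [exact: cvg_cst|exact: cvgM step_cvg0 step_cvg0].
    by rewrite !mulr0.
  have [N2 _ aN] : \forall n \near \oo, K * a n ^+ 2 < e / 3.
    exact: cvgr_lt Ka _ e3.
  have [[//|n] Nn un] := ux _ d0 (maxn N1 N2).+1.
  move: Nn; rewrite ltnS geq_max => /andP[N1n N2n].
  have h1 := zN _ N1n; have h2 := aN _ N2n; rewrite /= in h1 h2.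
  have h3 : `|E x - E (u n.+1)| < e / 3.
    by apply: Ed; rewrite -ball_normE /= distrC.
  have potE : pot n = E (u n.+1) + K * a n ^+ 2 by [].
  have h4 : 0 <= K * a n ^+ 2 by rewrite mulr_ge0 ?exprn_ge0.
  move: h1 h3; rewrite potE !ltr_norml ler_norml => /andP[? ?] /andP[? ?].
  by apply/andP; split; lra.
apply/eqP; rewrite -normr_le0; apply/ler_addgt0Pl => e e0; rewrite addr0.
have k0 : 0 < 1 + `|KE| + 2 * C by rewrite !ltr_wpDr ?mulr_ge0.
pose d := e / (1 + `|KE| + 2 * C).
have d0 : 0 < d by rewrite divr_gt0.
have [N _ aN] : \forall n \near \oo, a n < d by exact: cvgr_lt step_cvg0 _ d0.
have [[|[|n]]] := ux _ d0 N.+2; rewrite ?ltnS// => Nn un.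
have h1 := aN _ Nn; have h2 := aN _ (leqW Nn); rewrite /= in h1 h2.
have h3 : `|gE x| <= `|gE x - gE (u n.+2)| + `|gE (u n.+2)|.
  by rewrite -{1}[gE x](subrK (gE (u n.+2))) ler_normD.
have h4 : `|gE x - gE (u n.+2)| <= `|KE| * d.
  apply: le_trans (gE_lip _ _) _; rewrite distrC.
  apply: (@le_trans _ _ (`|KE| * `|u n.+2 - x|)).
    by rewrite ler_wpM2r ?ler_norm.
  by rewrite ler_wpM2l// ltW.
have h5 : C * (a n.+1 + a n) <= C * (d + d) by rewrite ler_wpM2l// lerD// ltW.
have -> : e = (1 + `|KE| + 2 * C) * d by rewrite mulrC divfK// gt_eqF.
have := relative_error n; lra.
Qed.

(** The Kurdyka-Lojasiewicz inequality multiplied by the drop of [pot] gives,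
    by concavity of [psi],
    [c * a n.+2 ^+ 2 <= (C + 4 * K) * (a n.+1 + a n) * (phi n.+1 - phi n.+2)],
    and taking square roots by the arithmetic-geometric mean inequality makes it
    linear. *)
Lemma KL_step x : E x = lim (pot @ \oo) -> gE x = 0 ->
  exists (phi : nat -> R) (rho : R) (N : nat),
  [/\ 0 < rho, forall n, (N <= n)%N -> 0 <= phi n, phi @ \oo --> (0 : R) &
    forall n, (N <= n)%N -> `|u n.+1 - x| < rho -> `|u n.+2 - x| < rho ->
      4 * a n.+2 <=
      a n.+1 + a n + 4 * (C + 4 * K) / c * (phi n.+1 - phi n.+2)].
Proof.
have [zeta potz zeta_le] := pot_cvg; rewrite (cvg_lim _ potz)// => Ex gx0.
have Ax : A (x, x) = zeta by rewrite /A /= subrr normr0 expr0n mulr0 addr0.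
have gAx : gA (x, x) = 0.
  apply/eqP; rewrite -normr_le0.
  apply: le_trans (norm_le_hnorm (inner_product_prod_dot hdot) _) _.
  by apply: le_trans (gA_le _) _; rewrite /= gx0 subrr !normr0 mulr0 addr0.
have [nu [psi [nu0 psiP KL]]] :=
  KL_smooth (inner_product_prod_dot hdot) A_grad gAx A_KL.
have [rho /= rho0 KLrho] : exists2 rho, 0 < rho & forall z, `|(x, x) - z| < rho ->
    A (x, x) < A z -> ((A z - A (x, x))%:E < nu)%E ->
    1 <= derive1 psi (A z - A (x, x)) * hnorm (prod_dot dot) (gA z).
  have /nbhs_normP[rho /= rho0 KLrho] := KL.
  by exists rho => // z xz; exact: KLrho.
have tz : (pot n - zeta) @[n --> \oo] --> (0 : R).
  by rewrite -(subrr zeta); apply: cvgB => //; exact: cvg_cst.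
have t_ge0 n : 0 <= pot n - zeta by rewrite subr_ge0.
have [N _ tN] : \forall n \near \oo, ((pot n - zeta)%:E < nu)%E.
  case: (nu) nu0 => [r|_|]//=; last by apply: nearW => k; exact: ltry.
  rewrite lte_fin => r0.
  have [N _ rN] : \forall n \near \oo, pot n - zeta < r.
    exact: cvgr_lt tz _ r0.
  by exists N => // n Nn; rewrite lte_fin; exact: rN.
exists (fun n => psi (pot n - zeta)), rho, N; split=> //.
- move=> n Nn; have [psi_ge0 _ _ _ _] := psiP.
  by apply: psi_ge0; split => //; exact: tN.
- exact: (desingularizing_cvg0 psiP nu0 t_ge0 tz).
move=> n Nn un1 un2; set b := a n.+1 + a n.
have b0 : 0 <= b by rewrite addr_ge0.
have CK : 0 <= C + 4 * K by rewrite addr_ge0 ?mulr_ge0.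
have st : pot n.+2 - zeta <= pot n.+1 - zeta.
  by rewrite lerD2r; exact: pot_nonincreasing.
have := decrease n.+1; have := t_ge0 n.+1.
(* If [pot] has reached its limit, the sequence does not move any more. *)
rewrite le_eqVlt => /predU1P[t0|t0] dec.
  have s0 : pot n.+2 - zeta = 0 by apply/eqP; rewrite eq_le t_ge0 andbT t0.
  rewrite -t0 s0 subrr mulr0 addr0.
  have : a n.+2 ^+ 2 <= 0 by rewrite -(pmulr_rle0 _ c_gt0); lra.
  by rewrite le_eqVlt ltNge sqr_ge0 orbF sqrf_eq0 => /eqP ->; rewrite mulr0.
have := desingularizing_derive_le psiP (t_ge0 n.+2) st t0 (tN _ (leqW Nn)).
have KLn : 1 <= derive1 psi (pot n.+1 - zeta) *
    hnorm (prod_dot dot) (gA (u n.+2, u n.+1)).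
  rewrite -Ax; apply: KLrho; rewrite ?Ax.
  - by rewrite [ltLHS]prod_normE /= gt_max !(distrC x) un1 un2.
  - by rewrite -subr_gt0.
  - exact: tN (leqW Nn).
move: KLn; rewrite -/(pot n.+1).
set dpsi := derive1 psi _; set phi1 := psi _; set phi2 := psi _ => KLn chord.
have gA_b := gA_seq_le n; rewrite -/b in gA_b.
have drop0 : 0 <= pot n.+1 - pot n.+2.
  by have := mulr_ge0 (ltW c_gt0) (sqr_ge0 (a n.+2)); lra.
have dpsi0 : 0 < dpsi.
  by have [_ _ _ _ /(_ _ t0 (tN _ (leqW Nn)))[]] := psiP.
have dropE : pot n.+1 - zeta - (pot n.+2 - zeta) = pot n.+1 - pot n.+2 by ring.
rewrite dropE in chord.
have phi0 : 0 <= phi1 - phi2.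
  by apply: le_trans chord; rewrite mulr_ge0 // ltW.
have drop_le : pot n.+1 - pot n.+2 <= (C + 4 * K) * b * (phi1 - phi2).
  apply: le_trans (ler_wpM2l (mulr_ge0 CK b0) chord).
  rewrite mulrA ler_peMl//; apply: (le_trans KLn).
  by rewrite mulrC ler_wpM2r// ltW.
apply: four_mul_le => //.
  by rewrite !mulr_ge0 ?invr_ge0 ?(ltW c_gt0).
rewrite -(ler_pM2l c_gt0).
have -> : c * (b * (4 * (C + 4 * K) / c * (phi1 - phi2))) =
    4 * ((C + 4 * K) * b * (phi1 - phi2)) by field; rewrite gt_eqF.
by lra.
Qed.

Lemma descent_seq_cvg :
  (exists2 x, u @ \oo --> x & is_gradient dot E x 0) /\
  (\sum_(0 <= n <oo) (`|u n.+1 - u n|)%:E < +oo)%E.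
Proof.
have [B uB] := descent_seq_bounded; have [zeta potz _] := pot_cvg.
have [x ux] := bounded_seq_cluster uB.
have [Ex gx0] := cluster_critical potz ux.
have [|phi [rho [N [rho0 phi0 phic step]]]] := KL_step _ gx0.
  by rewrite (cvg_lim _ potz).
have C'0 : 0 <= 4 * (C + 4 * K) / c.
  by rewrite divr_ge0 ?mulr_ge0 ?addr_ge0 ?mulr_ge0 ?(ltW c_gt0).
split; last exact: finite_length_sum step rho0 ux step_cvg0 phic.
exists x; last by rewrite -gx0.
exact: finite_length_cvg step rho0 ux step_cvg0 phic.
Qed.

End DescentSequence.

(** * Convergence of the algorithm *)

Theorem theorem1 (R : realType) (X : finNormedModType R)
    (dot : {dot X for idfun})
    (hdot : forall x : X, `|x| = hnorm dot x)
    (H F : X -> R) (h f : X -> X) (M : {linear X -> X})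
    (L dt alpha beta lbar lmax : R)
    (u y : nat -> X) (lam : nat -> R) :
  let E : X -> R := fun x => H x + F x in
  let A : X * X -> R := potential H F L dt in
  let gradA : X * X -> X * X := gradient (prod_dot dot) A in
  convex_function [set: convex_lmodType X] H ->
  (forall x, is_gradient dot H x (h x)) ->
  lipschitz h ->
  (forall x, is_gradient dot F x (f x)) ->
  0 < L -> L.-lipschitz f ->
  (forall a : R, bounded_set [set x | E x <= a]) ->
  (forall x z, dot (M x) z = dot x (M z)) ->
  (forall x, 0 <= dot (M x) x) ->
  0 < dt -> dt < 2 / (3 * L) ->
  0 < alpha -> 0 < beta -> beta < 1 -> 0 < lbar ->
  KL_function (prod_dot dot) (fun z => (A z)%:E) ->
  FlowBBAp_MPCLS dot H F f M dt alpha beta lbar u y lam ->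
  [set lam n | n in [set n : nat | (1 <= n)%N]] lmax ->
  ubound [set lam n | n in [set n : nat | (1 <= n)%N]] lmax ->
  lmax < Num.sqrt (4 / (3 * dt * L) - 1 / 2) - 1 ->
  [/\ (fun n => hnorm (prod_dot dot) (gradA (u n.+1, u n))) @ \oo --> (0 : R),
      [/\ nonincreasing_seq (fun n => A (u n.+1, u n)),
          exists zeta : R, (fun n => A (u n.+1, u n)) @ \oo --> zeta &
          bounded_set (range u)] &
      (exists2 ustar : X, u @ \oo --> ustar & is_gradient dot E ustar 0) /\
      (\sum_(0 <= n <oo) (`|u n.+1 - u n|)%:E < +oo)%E].
Proof.
move=> E A gradA H_convex H_grad h_lip F_grad L_gt0 f_lip E_level M_sym M_ge0.
move=> dt_gt0 _ alpha_gt0 beta_gt0 _ lbar_gt0 A_KL algo.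
move=> [n0 _ lam_n0] lam_ub lmax_lt.
have /pinfty_ex_gt0[Lh Lh_gt0 hLh] := h_lip.
have h_le x z : `|h x - h z| <= Lh * `|x - z| by exact: (hLh (x, z)).
have f_le x z : `|f x - f z| <= L * `|x - z| by exact: (f_lip (x, z)).
have [CM0 M_le0] := finite_dim_linear_bounded M.
have M_le x : `|M x| <= `|CM0| * `|x|.
  by apply: le_trans (M_le0 x) _; rewrite ler_wpM2r ?ler_norm.
pose r := (3 * dt)^-1; pose K := L / 2 + r.
have r_gt0 : 0 < r by rewrite invr_gt0 mulr_gt0.
have K_ge0 : 0 <= K by rewrite addr_ge0 ?divr_ge0 ?ltW.
have lam_gt0 n : 0 < lam n.
  by have [_ [k [-> _ _]] _] := algo n; rewrite mulr_gt0 ?exprn_gt0.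
have lmax_ge0 : 0 <= lmax by rewrite -lam_n0 ltW.
pose q := 4 * r - L / 2.
have Lq : L * (1 + lmax) ^+ 2 < q.
  have T_gt : 1 + lmax < Num.sqrt (4 / (3 * dt * L) - 1 / 2) by lra.
  have T_gt0 : 0 < 4 / (3 * dt * L) - 1 / 2.
    by rewrite -sqrtr_gt0 (le_lt_trans _ T_gt)// addr_ge0.
  have : (1 + lmax) ^+ 2 < 4 / (3 * dt * L) - 1 / 2.
    rewrite -[ltRHS]sqr_sqrtr ?(ltW T_gt0)//.
    by rewrite ltr_pXn2r ?nnegrE ?sqrtr_ge0 ?addr_ge0.
  (* The right-hand side is [q / L]. *)
  rewrite -(ltr_pM2l L_gt0) => /lt_le_trans; apply.
  by rewrite le_eqVlt; apply/orP; left; apply/eqP; rewrite /q /r; field;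
    rewrite !gt_eqF.
have q_ge0 : 0 <= q.
  by apply: le_trans (ltW Lq); rewrite mulr_ge0 ?exprn_ge0 ?addr_ge0 ?(ltW L_gt0).
pose c := q / (1 + lmax) ^+ 2 - L.
have c_gt0 : 0 < c.
  by rewrite subr_gt0 ltr_pdivlMr// exprn_gt0// ltr_pwDl.
pose gE x := h x + f x; pose C := Lh + L + 2 / dt + `|CM0| + 2 * r.
have C_ge0 : 0 <= C.
  by rewrite !addr_ge0 ?divr_ge0 ?mulr_ge0 ?(ltW L_gt0) ?(ltW Lh_gt0) ?(ltW r_gt0)
    ?(ltW dt_gt0).
have E_grad x : is_gradient dot E x (gE x).
  have [dH Hv] := H_grad x; have [dF Fv] := F_grad x.
  split; first exact: differentiableD.
  by move=> w; rewrite (diffD dH dF) /= Hv Fv /gE linearDl.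
have gE_le x z : `|gE x - gE z| <= (Lh + L) * `|x - z|.
  rewrite /gE opprD addrACA mulrDl; apply: le_trans (ler_normD _ _) _.
  exact: lerD (h_le _ _) (f_le _ _).
have A_grad z : is_gradient (prod_dot dot) A z (gradA z).
  have zgrad := is_gradient_potential hdot H_grad F_grad h_le f_le dt_gt0
    (ltW L_gt0) (ltW Lh_gt0) z.1 z.2.
  move: zgrad; rewrite -surjective_pairing => zgrad.
  by rewrite /gradA (gradient_eq (inner_product_prod_dot hdot) zgrad).
have gradA_le z : hnorm (prod_dot dot) (gradA z) <=
    `|gE z.1| + 4 * K * `|z.1 - z.2|.
  case: z => x z.
  have := gradient_potential_norm_le hdot H_grad F_grad h_le f_le dt_gt0
    (ltW L_gt0) (ltW Lh_gt0) x z.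
  exact.
have decr n : A (u n.+2, u n.+1) + c * `|u n.+2 - u n.+1| ^+ 2 <= A (u n.+1, u n).
  have [ymin [k [_ ok _]] u_next] := algo n.+1.
  apply: (potential_decrease hdot H_convex H_grad F_grad h_le f_le M_sym M_ge0
    dt_gt0 (ltW L_gt0) ymin (ltW alpha_gt0) _ q_ge0 u_next ok).
  by rewrite (ltW (lam_gt0 _))/=; apply: lam_ub; exists n.+1.
have err n : `|gE (u n.+2)| <= C * (`|u n.+2 - u n.+1| + `|u n.+1 - u n|).
  have [ymin _ u_next] := algo n.+1.
  exact: (gradE_bound hdot H_grad F_grad h_le f_le M_sym dt_gt0 (ltW Lh_gt0)
    ymin (normr_ge0 _) (ltW (lam_gt0 _)) M_le u_next).
split.
- exact: (gA_seq_cvg0 hdot E_grad gE_le E_level K_ge0 gradA_le c_gt0 decr err).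
- split.
  + by move=> i j ij; exact: (@pot_nonincreasing _ _ E K u c c_gt0 decr).
  + have [zeta potz _] :=
      pot_cvg hdot E_grad gE_le E_level K_ge0 c_gt0 decr.
    by exists zeta.
  + have [B uB] := descent_seq_bounded E_level K_ge0 c_gt0 decr.
    exists B; split; first exact: num_real.
    by move=> r' Br _ [n _ <-] /=; exact: le_trans (uB n) (ltW Br).
- exact: (descent_seq_cvg hdot E_grad gE_le E_level K_ge0 A_grad gradA_le A_KL
    c_gt0 C_ge0 decr err).
Qed.
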